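(* Each $1$-semiregular commutative ring $R$ is an elementary divisor ring and a semiregular ring.
   Context: All rings are commutative with identity and all modules are unitary. $R$ is $1$-semiregular if every finitely presented $R$-module $M$ is $1$-periodic, i.e. there is an exact sequence $0\to M\to P\to M\to 0$ with $P$ projective. $R$ is an elementary divisor ring if for every matrix $A$ with entries in $R$ there exist a diagonal matrix $D$ and invertible matrices $P,Q$ with entries in $R$ such that $PAQ=D$. $R$ is semiregular if every $R$-module embeds into a flat $R$-module. *)

(* Defs.v *)
From HB Require Import structures.
From mathcomp Require Import all_boot all_algebra.
From mathcomp Require Import boolp.

Set Implicit Arguments.
Unset Strict Implicit.
Unset Printing Implicit Defensive.

Import GRing.Theory.
Local Open Scope ring_scope.
Local Open Scope quotient_scope.

(* [comPzRingType] allows the zero ring, as "commutative ring with identity"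
   does; [lmodType R] is the type of unitary R-modules. *)

Definition surjective (A B : Type) (f : A -> B) : Prop :=
  forall y, exists x, f x = y.

Definition exact_at (R : comPzRingType) (A B C : lmodType R)
    (f : {linear A -> B}) (g : {linear B -> C}) : Prop :=
  forall y : B, g y = 0 <-> exists x : A, f x = y.

Definition short_exact (R : comPzRingType) (A B C : lmodType R)
    (f : {linear A -> B}) (g : {linear B -> C}) : Prop :=
  [/\ injective f, exact_at f g & surjective g].

Definition projective (R : comPzRingType) (P : lmodType R) : Prop :=
  forall (A B : lmodType R) (g : {linear A -> B}) (f : {linear P -> B}),
    surjective g -> exists h : {linear P -> A}, forall x, g (h x) = f x.

Definition finitely_presented (R : comPzRingType) (M : lmodType R) : Prop :=
  exists (m n : nat) (f : {linear 'rV[R]_m -> 'rV[R]_n})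
         (g : {linear 'rV[R]_n -> M}),
    exact_at f g /\ surjective g.

Definition one_periodic (R : comPzRingType) (M : lmodType R) : Prop :=
  exists (P : lmodType R) (i : {linear M -> P}) (q : {linear P -> M}),
    projective P /\ short_exact i q.

Definition one_semiregular (R : comPzRingType) : Prop :=
  forall M : lmodType R, finitely_presented M -> one_periodic M.

(* [unitmx] is only available over a [comUnitRingType]. *)
Definition mx_invertible (R : comPzRingType) (n : nat) (A : 'M[R]_n) : Prop :=
  exists B : 'M[R]_n, A *m B = 1%:M /\ B *m A = 1%:M.

Definition elementary_divisor_ring (R : comPzRingType) : Prop :=
  forall (m n : nat) (A : 'M[R]_(m, n)),
    exists (P : 'M[R]_m) (D : 'M[R]_(m, n)) (Q : 'M[R]_n),
      [/\ mx_invertible P, mx_invertible Q, is_diag_mx D & P *m A *m Q = D].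

(* The tensor product of M and N: a list of pairs stands for the formal sum of
   the corresponding pure tensors, and lists are identified modulo the
   congruence generated by the bilinearity relations. Additive inverses are
   obtained by scaling by -1. *)
Inductive tens_eq (R : comPzRingType) (M N : lmodType R) :
    seq (M * N) -> seq (M * N) -> Prop :=
| tens_refl s : tens_eq s s
| tens_sym s t : tens_eq s t -> tens_eq t s
| tens_trans s t u : tens_eq s t -> tens_eq t u -> tens_eq s u
| tens_cat s s' t t' :
    tens_eq s s' -> tens_eq t t' -> tens_eq (s ++ t) (s' ++ t')
| tens_catC s t : tens_eq (s ++ t) (t ++ s)
| tens_0l y : tens_eq [:: (0, y)] [::]
| tens_Dl x x' y : tens_eq [:: (x + x', y)] [:: (x, y); (x', y)]
| tens_Dr x y y' : tens_eq [:: (x, y + y')] [:: (x, y); (x, y')]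
| tens_Z a x y : tens_eq [:: (a *: x, y)] [:: (x, a *: y)].

Definition tens_eqb (R : comPzRingType) (M N : lmodType R) :
  rel (seq (M * N)) := fun s t => `[< tens_eq s t >].

Section Tensor.
Context (R : comPzRingType) (M N : lmodType R).
Notation teq := (@tens_eqb R M N).

Lemma tens_eqb_refl : reflexive teq.
Proof. by move=> s; apply/asboolP/tens_refl. Qed.

Lemma tens_eqb_sym : symmetric teq.
Proof. by move=> s t; apply/asboolP/asboolP; apply: tens_sym. Qed.

Lemma tens_eqb_trans : transitive teq.
Proof.
by move=> t s u /asboolP st /asboolP tu; apply/asboolP/(tens_trans st tu).
Qed.

Definition tens_equiv : equiv_rel (seq (M * N)) :=
  EquivRel teq tens_eqb_refl tens_eqb_sym tens_eqb_trans.

Definition tensor : Type := {eq_quot tens_equiv}.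

HB.instance Definition _ := EqQuotient.on tensor.
HB.instance Definition _ := Choice.on tensor.

Lemma tensor_eqP (s t : seq (M * N)) :
  \pi_tensor s = \pi_tensor t <-> tens_eq s t.
Proof.
split=> [/eqP|st]; last by apply/eqP; rewrite eqmodE; apply/asboolP.
by rewrite eqmodE => /asboolP.
Qed.

Definition tensor_zero : tensor := \pi_tensor [::].
Definition tensor_add (u v : tensor) : tensor := \pi_tensor (repr u ++ repr v).
Definition tensor_scale (a : R) (u : tensor) : tensor :=
  \pi_tensor [seq (a *: p.1, p.2) | p <- repr u].
Definition tensor_opp (u : tensor) : tensor := tensor_scale (-1) u.

Lemma tens_eq_repr_pi (s : seq (M * N)) : tens_eq (repr (\pi_tensor s)) s.
Proof. by apply/tensor_eqP; rewrite reprK. Qed.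

Lemma tensor_add_pi (s t : seq (M * N)) :
  tensor_add (\pi_tensor s) (\pi_tensor t) = \pi_tensor (s ++ t).
Proof. by apply/tensor_eqP/tens_cat; apply: tens_eq_repr_pi. Qed.

Lemma tens_eq_scale (a : R) (s t : seq (M * N)) : tens_eq s t ->
  tens_eq [seq (a *: p.1, p.2) | p <- s] [seq (a *: p.1, p.2) | p <- t].
Proof.
elim=> {s t} [s|s t _|s t u _ st _|s s' t t' _ ss' _|s t|y|x x' y|x y y'|b x y] /=.
- exact: tens_refl.
- exact: tens_sym.
- exact: tens_trans.
- by rewrite !map_cat; apply: tens_cat.
- by rewrite !map_cat; apply: tens_catC.
- by rewrite scaler0; apply: tens_0l.
- by rewrite scalerDr; apply: tens_Dl.
- exact: tens_Dr.
- by rewrite scalerA mulrC -scalerA; apply: tens_Z.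
Qed.

Lemma tensor_scale_pi (a : R) (s : seq (M * N)) :
  tensor_scale a (\pi_tensor s) = \pi_tensor [seq (a *: p.1, p.2) | p <- s].
Proof. by apply/tensor_eqP/tens_eq_scale/tens_eq_repr_pi. Qed.

Lemma tensor_addA : associative tensor_add.
Proof.
move=> u v w; rewrite -[u]reprK -[v]reprK -[w]reprK.
set s := repr u; set t := repr v; set r := repr w.
by rewrite (tensor_add_pi t r) (tensor_add_pi s t) !tensor_add_pi catA.
Qed.

Lemma tensor_addC : commutative tensor_add.
Proof.
move=> u v; rewrite -[u]reprK -[v]reprK.
rewrite (tensor_add_pi (repr u) (repr v)) (tensor_add_pi (repr v) (repr u)).
exact/tensor_eqP/tens_catC.
Qed.

Lemma tensor_add0 : left_id tensor_zero tensor_add.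
Proof. by move=> u; rewrite -[u]reprK tensor_add_pi. Qed.

Lemma tensor_scaleDl (a b : R) (u : tensor) :
  tensor_scale (a + b) u = tensor_add (tensor_scale a u) (tensor_scale b u).
Proof.
rewrite -[u]reprK !tensor_scale_pi tensor_add_pi; apply/tensor_eqP.
elim: (repr u) => [|[x y] s IH] /=; first exact: tens_refl.
rewrite scalerDl -cat1s.
apply: (tens_trans (tens_cat (tens_Dl _ _ _) IH)).
rewrite -[X in tens_eq X _]/([:: (a *: x, y)] ++ ([:: (b *: x, y)] ++ _)).
rewrite -[X in tens_eq _ X]/([:: (a *: x, y)] ++ (_ ++ _)).
apply: tens_cat; first exact: tens_refl.
rewrite -[(b *: x, y) :: [seq _ | p <- s]]cat1s !catA.
by apply: tens_cat; [apply: tens_catC | apply: tens_refl].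
Qed.

Lemma tensor_scale0 (u : tensor) : tensor_scale 0 u = tensor_zero.
Proof.
rewrite -[u]reprK tensor_scale_pi; apply/tensor_eqP.
elim: (repr u) => [|[x y] s IH] /=; first exact: tens_refl.
rewrite scale0r -cat1s -[[::] in X in tens_eq _ X]/([::] ++ [::]).
exact: tens_cat (tens_0l _ _) IH.
Qed.

Lemma tensor_scaleA (a b : R) (u : tensor) :
  tensor_scale a (tensor_scale b u) = tensor_scale (a * b) u.
Proof.
rewrite -[u]reprK; set s := repr u.
rewrite (tensor_scale_pi b s) (tensor_scale_pi (a * b) s) tensor_scale_pi.
rewrite -map_comp; congr (\pi_tensor _).
by apply: eq_map => p /=; rewrite scalerA.
Qed.

Lemma tensor_scale1 : left_id 1 tensor_scale.
Proof.
move=> u; rewrite -[u]reprK tensor_scale_pi; congr (\pi_tensor _).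
by rewrite -[RHS]map_id; apply: eq_map => -[x y] /=; rewrite scale1r.
Qed.

Lemma tensor_scaleDr (a : R) (u v : tensor) :
  tensor_scale a (tensor_add u v)
  = tensor_add (tensor_scale a u) (tensor_scale a v).
Proof.
rewrite -[u]reprK -[v]reprK.
set s := repr u; set t := repr v.
rewrite (tensor_add_pi s t) (tensor_scale_pi a s) (tensor_scale_pi a t).
by rewrite tensor_scale_pi tensor_add_pi map_cat.
Qed.

Lemma tensor_addN : left_inverse tensor_zero tensor_opp tensor_add.
Proof.
move=> u; rewrite -[u in X in tensor_add _ X]tensor_scale1 -tensor_scaleDl.
by rewrite addNr tensor_scale0.
Qed.

HB.instance Definition _ := GRing.isZmodule.Build tensor
  tensor_addA tensor_addC tensor_add0 tensor_addN.

HB.instance Definition _ := GRing.Zmodule_isLmodule.Build R tensor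
  tensor_scaleA tensor_scale1 tensor_scaleDr
  (fun u a b => tensor_scaleDl a b u).

Definition tens (x : M) (y : N) : tensor := \pi_tensor [:: (x, y)].

Lemma tensDl x x' y : tens (x + x') y = tens x y + tens x' y.
Proof. by rewrite [RHS]tensor_add_pi; apply/tensor_eqP/tens_Dl. Qed.

Lemma tensDr x y y' : tens x (y + y') = tens x y + tens x y'.
Proof. by rewrite [RHS]tensor_add_pi; apply/tensor_eqP/tens_Dr. Qed.

Lemma tensZl a x y : tens (a *: x) y = a *: tens x y.
Proof. by rewrite [RHS]tensor_scale_pi. Qed.

Lemma tensZr a x y : tens x (a *: y) = a *: tens x y.
Proof. by rewrite -tensZl; apply/tensor_eqP/tens_sym/tens_Z. Qed.

Lemma pi_tensorE (s : seq (M * N)) :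
  \pi_tensor s = \sum_(p <- s) tens p.1 p.2.
Proof.
elim: s => [|[x y] s IH]; first by rewrite big_nil.
by rewrite big_cons -IH [RHS]tensor_add_pi.
Qed.

Lemma tensor_ind (P : tensor -> Prop) :
  P 0 -> (forall x y u, P u -> P (tens x y + u)) -> forall u, P u.
Proof.
move=> P0 PD u; rewrite -[u]reprK pi_tensorE.
by elim: (repr u) => [|p s IH]; rewrite ?big_nil ?big_cons //; apply: PD.
Qed.

Section Lift.
Context (L : lmodType R) (b : M -> N -> L).
Hypotheses (bl : forall y, linear (b^~ y)) (br : forall x, linear (b x)).

Definition tensor_lift_fun (u : tensor) : L := \sum_(p <- repr u) b p.1 p.2.

Lemma tensor_lift_pi (s : seq (M * N)) :
  tensor_lift_fun (\pi_tensor s) = \sum_(p <- s) b p.1 p.2.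
Proof.
have bDl x x' y : b (x + x') y = b x y + b x' y.
  by have := bl y 1 x x'; rewrite !scale1r.
have bDr x y y' : b x (y + y') = b x y + b x y'.
  by have := br x 1 y y'; rewrite !scale1r.
have b0l y : b 0 y = 0 by apply: (addrI (b 0 y)); rewrite -bDl !addr0.
have b0r x : b x 0 = 0 by apply: (addrI (b x 0)); rewrite -bDr !addr0.
rewrite /tensor_lift_fun.
move: (repr _) (tens_eq_repr_pi s) => r; elim=> {r s}.
- by [].
- by move=> s t _ ->.
- by move=> s t u _ -> _ ->.
- by move=> s s' t t' _ e _ e'; rewrite !big_cat /= e e'.
- by move=> s t; rewrite !big_cat /= addrC.
- by move=> y; rewrite big_seq1 big_nil.
- by move=> x x' y; rewrite !big_cons !big_nil !addr0 /= bDl.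
- by move=> x y y'; rewrite !big_cons !big_nil !addr0 /= bDr.
- move=> a x y; rewrite !big_seq1 /=.
  have := bl y a x 0; rewrite addr0 b0l addr0 => ->.
  by have := br x a y 0; rewrite addr0 b0r addr0 => ->.
Qed.

Lemma tensor_lift_linear : linear tensor_lift_fun.
Proof.
move=> a u v; rewrite -[u]reprK -[v]reprK.
rewrite [a *: _]tensor_scale_pi [_ + _]tensor_add_pi !tensor_lift_pi.
rewrite big_cat big_map /= scaler_sumr; congr (_ + _); apply: eq_bigr => p _.
have b0l y : b 0 y = 0.
  by have := bl y 1 0 0; rewrite scale1r addr0 scale1r => /esym/eqP;
     rewrite -subr_eq0 addrK => /eqP.
by have := bl p.2 a p.1 0; rewrite addr0 b0l addr0.
Qed.

HB.instance Definition _ :=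
  GRing.isLinear.Build R tensor L *:%R tensor_lift_fun tensor_lift_linear.

Definition tensor_lift : {linear tensor -> L} := tensor_lift_fun.

Lemma tensor_liftE x y : tensor_lift (tens x y) = b x y.
Proof. by rewrite [LHS]tensor_lift_pi big_seq1. Qed.
End Lift.

Lemma tensor_lift_uniq (L : lmodType R) (g h : {linear tensor -> L}) :
  (forall x y, g (tens x y) = h (tens x y)) -> g =1 h.
Proof.
move=> gh; elim/tensor_ind => [|x y u IH]; first by rewrite !linear0.
by rewrite !linearD gh IH.
Qed.
End Tensor.

Section TensorMap.
Context (R : comPzRingType) (A B N : lmodType R) (f : {linear A -> B}).

Lemma tensor_map_linearl y : linear (fun x : A => tens (f x) y : tensor B N).
Proof. by move=> a x x'; rewrite linearP tensDl tensZl. Qed.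

Lemma tensor_map_linearr x : linear (fun y : N => tens (f x) y : tensor B N).
Proof. by move=> a y y'; rewrite tensDr tensZr. Qed.

(* The map f (x) id_N from A (x) N to B (x) N. *)
Definition tensor_map : {linear tensor A N -> tensor B N} :=
  tensor_lift tensor_map_linearl tensor_map_linearr.

Lemma tensor_mapE x y : tensor_map (tens x y) = tens (f x) y.
Proof. exact: tensor_liftE. Qed.
End TensorMap.

Definition flat (R : comPzRingType) (F : lmodType R) : Prop :=
  forall (A B : lmodType R) (f : {linear A -> B}),
    injective f -> injective (tensor_map F f).

Definition semiregular (R : comPzRingType) : Prop :=
  forall M : lmodType R,
    exists (F : lmodType R) (f : {linear M -> F}), flat F /\ injective f.

(* Main.v *)
From HB Require Import structures.
Require Import Defs.
From mathcomp Require Import all_boot all_algebra.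
From mathcomp Require Import perm boolp functions ring.

(** The hypothesis enters through matrices. For a matrix [B] with cokernel [M],
    the middle term of [0 -> M -> P -> M -> 0] has a block triangular relation
    matrix [N] with two copies of [B] on the diagonal, and [P] projective means
    [N = N Y N] for some [Y] (periodic_relations).

    Elementary divisors. For [M = R / aR], determinants give
    [a ^+ 2 = a ^+ 4 * x], so on suitable components of [R] each element is a
    unit or has square zero. For [M = R / (aR + bR)] with [a] and [b] of square
    zero, the minors of [N] vanish, and this makes [a] and [b] comparable for
    divisibility, up to an idempotent decomposition of the ring
    (one_semiregular_comparable). Locally [R] is thus a chain ring, with
    idempotents to patch local transformations: invertible matrices on the
    components glue to an invertible matrix. So one can move to the corner of a
    matrix an element that divides every entry, clear its row and column, and
    proceed by induction (comparable_elementary_divisor_ring).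

    Semiregularity. Since [M] embeds into [P], every row space is the kernel of
    a matrix, and by transposition every kernel is a row space, so [R] is
    coherent. An arbitrary module [M] is a filtered colimit of finitely
    presented modules, each of which embeds into the power of [R] indexed by its
    linear functionals. The colimit of these powers is realised as the module
    of germs of functions of a functional [psi : M -> R] as [psi] becomes linear
    (envelope); [M] embeds into it by evaluation (linear_on_separates).
    Coherence gives the equational criterion of flatness for it
    (envelope_equationally_flat), and the criterion implies flatness
    (equationally_flat_flat): under it, every equality in the tensor product
    lifts to a tensor product with a free module of finite rank. *)

Set Implicit Arguments.
Unset Strict Implicit.
Unset Printing Implicit Defensive.

Import GRing.Theory.
Local Open Scope ring_scope.
Local Open Scope quotient_scope.

(** * Quotient modules *)

Record submodule (R : comPzRingType) (V : lmodType R) := Submodule {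
  in_submodule :> V -> Prop;
  submodule0 : in_submodule 0;
  submoduleP : forall a x y,
    in_submodule x -> in_submodule y -> in_submodule (a *: x + y)
}.

Section QuotientModule.
Context (R : comPzRingType) (V : lmodType R) (N : submodule V).

Lemma submoduleZ a x : N x -> N (a *: x).
Proof. by move=> Nx; rewrite -[_ *: _]addr0; apply/submoduleP/submodule0. Qed.

Lemma submoduleD x y : N x -> N y -> N (x + y).
Proof. by move=> Nx Ny; rewrite -[x]scale1r; apply: submoduleP. Qed.

Definition eq_mod : rel V := fun x y => `[< N (x - y) >].

Lemma eq_mod_refl : reflexive eq_mod.
Proof. by move=> x; apply/asboolP; rewrite subrr; apply: submodule0. Qed.

Lemma eq_mod_sym : symmetric eq_mod.
Proof.
by move=> x y; apply/asboolP/asboolP => /(submoduleZ (-1));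
   rewrite scaleN1r opprB.
Qed.

Lemma eq_mod_trans : transitive eq_mod.
Proof.
move=> y x z /asboolP xy /asboolP yz; apply/asboolP.
by rewrite -[x](subrK y) -addrA; apply: submoduleD.
Qed.

Definition eq_mod_equiv : equiv_rel V :=
  EquivRel eq_mod eq_mod_refl eq_mod_sym eq_mod_trans.

Definition quotient : Type := {eq_quot eq_mod_equiv}.

HB.instance Definition _ := EqQuotient.on quotient.
HB.instance Definition _ := Choice.on quotient.

Definition class (x : V) : quotient := \pi_quotient x.

Lemma class_eqP x y : class x = class y <-> N (x - y).
Proof.
split=> [/eqP|xy]; last by apply/eqP; rewrite eqmodE; apply/asboolP.
by rewrite eqmodE => /asboolP.
Qed.

Lemma class_repr (u : quotient) : class (repr u) = u.
Proof. exact: reprK. Qed.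

Definition quotient_add (u v : quotient) := class (repr u + repr v).
Definition quotient_scale a (u : quotient) := class (a *: repr u).

Lemma quotient_add_class x y : quotient_add (class x) (class y) = class (x + y).
Proof.
apply/class_eqP; rewrite opprD addrACA.
by apply: submoduleD; apply/class_eqP/class_repr.
Qed.

Lemma quotient_scale_class a x : quotient_scale a (class x) = class (a *: x).
Proof.
by apply/class_eqP; rewrite -scalerBr; apply/submoduleZ/class_eqP/class_repr.
Qed.

Let classE := (quotient_add_class, quotient_scale_class).

Lemma quotient_addA : associative quotient_add.
Proof.
move=> u v w; rewrite -[u]class_repr -[v]class_repr -[w]class_repr.
by rewrite !classE addrA.
Qed.

Lemma quotient_addC : commutative quotient_add.
Proof. by move=> u v; rewrite -[u]class_repr -[v]class_repr !classE addrC. Qed.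

Lemma quotient_add0 : left_id (class 0) quotient_add.
Proof. by move=> u; rewrite -[u]class_repr !classE add0r. Qed.

Lemma quotient_addN :
  left_inverse (class 0) (quotient_scale (-1)) quotient_add.
Proof. by move=> u; rewrite -[u]class_repr !classE scaleN1r addNr. Qed.

HB.instance Definition _ := GRing.isZmodule.Build quotient
  quotient_addA quotient_addC quotient_add0 quotient_addN.

Lemma quotient_scaleA a b u :
  quotient_scale a (quotient_scale b u) = quotient_scale (a * b) u.
Proof. by rewrite -[u]class_repr !classE scalerA. Qed.

Lemma quotient_scale1 : left_id 1 quotient_scale.
Proof. by move=> u; rewrite -[u]class_repr !classE scale1r. Qed.

Lemma quotient_scaleDr : right_distributive quotient_scale +%R.
Proof.
move=> a u v; rewrite -[u]class_repr -[v]class_repr.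
by rewrite /GRing.add /= !classE scalerDr.
Qed.

Lemma quotient_scaleDl u :
  {morph quotient_scale^~ u : a b / a + b}.
Proof.
move=> a b; rewrite -[u]class_repr !classE scalerDl.
by rewrite -quotient_add_class.
Qed.

HB.instance Definition _ := GRing.Zmodule_isLmodule.Build R quotient
  quotient_scaleA quotient_scale1 quotient_scaleDr quotient_scaleDl.

Lemma class_linear : linear class.
Proof. by move=> a x y; rewrite -quotient_add_class -quotient_scale_class. Qed.

HB.instance Definition _ :=
  GRing.isLinear.Build R V quotient *:%R class class_linear.

Lemma class_eq0 x : class x = 0 <-> N x.
Proof. by rewrite -[0]/(class 0) class_eqP subr0. Qed.

Lemma class_surj (u : quotient) : exists x, class x = u.
Proof. by exists (repr u); rewrite class_repr. Qed.
End QuotientModule.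

(** * Linear combinations and row spaces *)

Section Combination.
Context (R : comPzRingType) (F : lmodType R).

Definition comb k (y : 'I_k -> F) (r : 'rV[R]_k) : F := \sum_j r 0 j *: y j.

Lemma comb_linear k (y : 'I_k -> F) : linear (comb y).
Proof.
move=> a r s; rewrite /comb scaler_sumr -big_split /=; apply: eq_bigr => j _.
by rewrite !mxE scalerDl scalerA.
Qed.

HB.instance Definition _ k (y : 'I_k -> F) :=
  GRing.isLinear.Build R 'rV[R]_k F *:%R (comb y) (comb_linear y).

Lemma comb_delta k (y : 'I_k -> F) j : comb y (delta_mx 0 j) = y j.
Proof.
rewrite /comb (bigD1 j) //= big1 ?addr0 => [|i /negbTE ij].
  by rewrite mxE !eqxx scale1r.
by rewrite mxE eqxx ij scale0r.
Qed.

Lemma linear_row_ext k (g h : {linear 'rV[R]_k -> F}) :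
  (forall j, g (delta_mx 0 j) = h (delta_mx 0 j)) -> g =1 h.
Proof.
move=> gh v; rewrite (row_sum_delta v) !linear_sum; apply: eq_bigr => j _.
by rewrite !linearZ gh.
Qed.
End Combination.

Section RowSpace.
Context (R : comPzRingType) (m n : nat) (B : 'M[R]_(m, n)).

Lemma rowspaceP a (x y : 'rV[R]_n) :
  (exists w, x = w *m B) -> (exists w, y = w *m B) ->
  exists w, a *: x + y = w *m B.
Proof.
move=> [v ->] [w ->]; exists (a *: v + w).
by rewrite mulmxDl scalemxAl.
Qed.

Lemma rowspace0 : exists w : 'rV_m, 0 = w *m B.
Proof. by exists 0; rewrite mul0mx. Qed.

Definition rowspace := Submodule rowspace0 rowspaceP.
End RowSpace.

Lemma coker_finitely_presented (R : comPzRingType) m n (B : 'M[R]_(m, n)) :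
  finitely_presented (quotient (rowspace B)).
Proof.
exists m, n, (mulmxr B), (class (rowspace B)); split; last exact: class_surj.
move=> v; split=> [/class_eq0 [w ->]|[w <-]]; first by exists w.
by apply/class_eq0; exists w.
Qed.

(** * Relation matrices of the middle term *)

(** This lemma extracts from the hypothesis all that the proof uses.
    Let [M] be the cokernel of [B] and [0 -> M -> P -> M -> 0] the exact
    sequence with [P] projective. As in the horseshoe lemma, generators of both
    copies of [M] give [2n] generators of [P], whose relations are the rows of
    a block triangular matrix [N] with [B] on the diagonal. Since [P] is
    projective, the row space of [N] is a direct summand, so [N = N Y N]
    for some [Y]. The last clause says that the first copy of [M] still embeds
    into [P]: no new relations between its generators appear. *)
Lemma periodic_relations (R : comPzRingType) (hR : one_semiregular R)
    m n (B : 'M[R]_(m, n)) :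
  exists (C : 'M[R]_(m, n)) (Y : 'M[R]_(n + n, m + m)),
    block_mx B 0 C B *m Y *m block_mx B 0 C B = block_mx B 0 C B /\
    forall (v : 'rV[R]_n) w,
      row_mx v 0 = w *m block_mx B 0 C B -> exists u, v = u *m B.
Proof.
have [P [i [q [projP [i_inj exq q_surj]]]]] :=
  hR _ (coker_finitely_presented B).
pose cl : {linear 'rV[R]_n -> _} := class (rowspace B).
have cl_surj u : exists v, cl v = u by apply: class_surj.
have clB w : cl (w *m B) = 0 by apply/class_eq0; exists w.
have qi x : q (i x) = 0 by apply/exq; exists x.
have [y yE] := choice (fun j => q_surj (cl (delta_mx 0 j))).
(* [lam] lifts the presentation [cl] of the quotient [M] along [q]. *)
pose lam : {linear 'rV[R]_n -> P} := comb y.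
have qlam : q \o lam =1 cl.
  by apply: linear_row_ext => j /=; rewrite comb_delta yE.
have [c cE] : exists c : 'I_m -> 'rV[R]_n,
    forall k, lam (row k B) = - i (cl (c k)).
  suff /choice[c cE] : forall k, exists c : 'rV[R]_n,
      lam (row k B) = - i (cl c).
    by exists c.
  move=> k; have /exq [x xE] : q (lam (row k B)) = 0.
    by rewrite [LHS]qlam rowE clB.
  have [v vx] := cl_surj x.
  by exists (- v); rewrite !linearN opprK -xE -vx.
pose C := \matrix_k c k.
have lamC w : lam (w *m B) = - i (cl (w *m C)).
  rewrite !mulmx_sum_row !linear_sum; apply: eq_bigr => k _.
  by rewrite !linearZ /= cE rowK.
pose N := block_mx B 0 C B.
pose p (x : 'rV[R]_(n + n)) := i (cl (lsubmx x)) + lam (rsubmx x).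
have p_lin : linear p.
  by move=> a x z; rewrite /p !linearP scalerDr addrACA.
pose pL := GRing.isLinear.Build _ _ _ _ p p_lin.
pose p' : {linear 'rV[R]_(n + n) -> P} := HB.pack p pL.
have p_row u v : p (row_mx u v) = i (cl u) + lam v.
  by rewrite /p row_mxKl row_mxKr.
have NE w1 w2 : row_mx w1 w2 *m N = row_mx (w1 *m B + w2 *m C) (w2 *m B).
  by rewrite mul_row_block mulmx0 add0r.
have pN w : p (w *m N) = 0.
  rewrite -[w]hsubmxK NE p_row lamC linearD clB add0r.
  by rewrite subrr.
have kerp x : p x = 0 -> exists w, x = w *m N.
  rewrite -[x]hsubmxK; move: (lsubmx x) (rsubmx x) => u v; rewrite p_row => uv0.
  have /class_eq0 [w2 vE] : cl v = 0.
    by rewrite -qlam /= -[lam v](addKr (i (cl u))) uv0 addr0 linearN qi oppr0.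
  move: uv0; rewrite vE lamC -linearN -linearD -[RHS](linear0 i) => /i_inj.
  rewrite -linearN -linearD => /class_eq0 [w1 w1E].
  by exists (row_mx w1 w2); rewrite NE -w1E subrK.
have p_surj : surjective p'.
  move=> z; have [v vE] := cl_surj (q z).
  have /exq [x xE] : q (z - lam v) = 0.
    by rewrite linearB [q (lam v)]qlam /= vE subrr.
  have [u uE] := cl_surj x.
  by exists (row_mx u v); rewrite /= p_row uE xE subrK.
(* A section [s] of [p] makes [x |-> x - s (p x)] a projection onto the kernel
   of [p], which is the row space of [N]. *)
have [s sE] := projP _ _ p' idfun p_surj.
have [Y YE] : exists Y : 'M[R]_(n + n, m + m),
    forall x, x - s (p x) = x *m Y *m N.
  have /choice[w wE] : forall j, exists w,
      delta_mx 0 j - s (p (delta_mx 0 j)) = w *m N.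
    move=> j; apply: kerp; rewrite -[p _]/(p' _) linearB /=.
    by rewrite -[p (s _)]/(p' _) sE subrr.
  exists (\matrix_j w j).
  have := @linear_row_ext _ _ _ (idfun \- (s \o p'))
    (mulmxr N \o mulmxr (\matrix_j w j)).
  by apply => j /=; rewrite wE -rowE rowK.
exists C, Y; split.
  apply/row_matrixP => k; rewrite !row_mul -YE.
  by rewrite rowE pN linear0 subr0.
move=> v w vE; have := pN w; rewrite -vE p_row linear0 addr0 -[0](linear0 i).
by move/i_inj/class_eq0.
Qed.

(** * Comparing two elements up to idempotents *)

(** For the module [R / aR] the relation matrix [N] of the middle term is
    triangular with [a] twice on the diagonal, so [a ^+ 2] is its determinant,
    and [N = N Y N] passes to determinants. *)
Lemma one_semiregular_sqr (R : comPzRingType) (hR : one_semiregular R) (a : R) :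
  exists x, a ^+ 2 = a ^+ 4 * x.
Proof.
have [C [Y [NYN _]]] := periodic_relations hR (a%:M : 'M_1).
exists (\det Y); move/(congr1 determinant): NYN.
rewrite !det_mulmx det_lblock det_scalar1 => eq_a.
by rewrite expr2 -eq_a; ring.
Qed.

(** The hypotheses say that [E], with rows [(p, q)] and [(r, s)], fixes the
    matrix with rows [(c, a)] and [(d, b)] under right multiplication; take
    determinants. *)
Lemma minor_mul_det (R : comPzRingType) (a b c d p q r s : R) :
  c * p + a * r = c -> d * p + b * r = d ->
  c * q + a * s = a -> d * q + b * s = b ->
  c * b - d * a = (c * b - d * a) * (p * s - q * r).
Proof.
move=> cE dE aE bE.
transitivity ((c * p + a * r) * (d * q + b * s) -
              (d * p + b * r) * (c * q + a * s)); last by ring.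
by rewrite cE dE aE bE.
Qed.

(** Apply the relation matrix [N] to the module [R / (aR + bR)]; its rows are
    [(a, 0)], [(b, 0)], [(c, a)] and [(d, b)]. The matrix [E = Y N] fixes [N],
    and its second column has entries in the nil ideal [aR + bR]. Hence
    [det E] is nilpotent and every minor of [N] vanishes, in particular
    [c * b - d * a]. The second relation is the equation [a * p = a] in
    [N E = N], where [p], the corner of [E], is a combination of [a], [b], [c]
    and [d]; the term in [a ^+ 2] vanishes and [d * a] is a multiple of [b]. *)
Lemma one_semiregular_pair (R : comPzRingType) (hR : one_semiregular R)
    (a b : R) :
  a ^+ 2 = 0 -> b ^+ 2 = 0 ->
  exists c d y w, d * a = c * b /\ a = b * w + y * c * a.
Proof.
move=> a2 b2.
pose B : 'M[R]_(2, 1) := \matrix_(i, j) if i == 0 then a else b.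
have [C [Y [NYN _]]] := periodic_relations hR B.
pose c := C 0 0; pose d := C 1 0.
pose y := ulsubmx Y; pose z := ursubmx Y.
pose u := dlsubmx Y; pose v := drsubmx Y.
(* Read [N (Y N) = N] blockwise, then entrywise. *)
move: NYN; rewrite -mulmxA -[Y]submxK !mulmx_block.
rewrite !mulmx0 !mul0mx !add0r !addr0 -/y -/z -/u -/v.
move=> /eq_block_mx [BP BQ CP CQ].
have ord2 (F : 'I_2 -> R) : \sum_i F i = F 0 + F 1.
  by rewrite big_ord_recl big_ord1; congr (_ + F _); apply: val_inj.
have entry i : _ := (congr1 (fun A : 'M_(2, 1) => A i 0) BP,
  congr1 (fun A : 'M_(2, 1) => A i 0) CP,
  congr1 (fun A : 'M_(2, 1) => A i 0) CQ).
move: (entry 0) (entry 1) => {entry}.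
rewrite !mxE !big_ord1 !mxE !ord2 !mxE /= -[C 0 ord0]/c -[C 1 ord0]/d.
move: (Y _ (lshift _ 0)) (Y _ (lshift _ 1))
      (Y _ (rshift _ 0)) (Y _ (rshift _ 1)).
move: (Y _ (lshift _ 0)) (Y _ (lshift _ 1))
      (Y _ (rshift _ 0)) (Y _ (rshift _ 1)).
move=> u0 u1 v0 v1 y0 y1 z0 z1.
set p := y0 * a + _ + _; set r := u0 * a + _ + _.
move=> [[ap cp] cq] [[_ dp] dq].
have minor : c * b - d * a = 0.
  set t := p * v0 - r * z0; set t' := p * v1 - r * z1.
  have detE : c * b - d * a = (c * b - d * a) * (a * t + b * t').
    by rewrite [LHS](minor_mul_det cp dp cq dq) /t /t'; ring.
  (* The determinant [a * t + b * t'] has cube zero. *)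
  rewrite detE detE detE.
  have -> : (c * b - d * a) * (a * t + b * t') *
      (a * t + b * t') * (a * t + b * t') =
      (c * b - d * a) * (a ^+ 2 * (a * t ^+ 3 + 3%:R * t ^+ 2 * b * t') +
       b ^+ 2 * (b * t' ^+ 3 + 3%:R * t' ^+ 2 * a * t)) by ring.
  by rewrite a2 b2 !mul0r addr0 mulr0.
have da : d * a = c * b by apply/esym/eqP; rewrite -subr_eq0 minor.
exists c, d, z0, (y1 * a + z1 * c); split=> //.
rewrite -[LHS]ap /p.
transitivity (y0 * a ^+ 2 + y1 * a * b + z0 * c * a + z1 * (d * a)).
  by ring.
by rewrite a2 da; ring.
Qed.

(** Over a local ring this says that [a] divides [b] or [b] divides [a]; in
    general one alternative holds on the component [e] and the other on
    [1 - e]. *)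
Definition idempotent_comparable (R : comPzRingType) : Prop :=
  forall a b : R,
    exists e x y, [/\ e * e = e, e * b = a * x & (1 - e) * a = b * y].

(** The relation [c ^+ 2 = c ^+ 4 * u] splits the ring into a component where
    [c] is a unit and one where [c ^+ 2 = 0]. Splitting for [a] and for [b], the
    components where one of them is a unit are clear. Where both have square
    zero, take [c] and [d] with [d * a = c * b] and [a = y * c * a] modulo [b]:
    if [c] is a unit then [a] divides [b]; if [c ^+ 2 = 0] then iterating the
    second relation gives [a = 0] modulo [b]. *)
Lemma one_semiregular_comparable (R : comPzRingType) :
  one_semiregular R -> idempotent_comparable R.
Proof.
move=> hR a b.
have [v aE] := one_semiregular_sqr hR a.
have [w bE] := one_semiregular_sqr hR b.
pose e1 := a ^+ 2 * v; pose e2 := b ^+ 2 * w.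
have e1e1 : e1 * e1 = e1.
  by transitivity (a ^+ 4 * v * v); rewrite /e1; [ring | rewrite -aE; ring].
have e2e2 : e2 * e2 = e2.
  by transitivity (b ^+ 4 * w * w); rewrite /e2; [ring | rewrite -bE; ring].
have a2 : (1 - e1) * a ^+ 2 = 0.
  by rewrite mulrBl mul1r {1}aE /e1; ring.
have b2 : (1 - e2) * b ^+ 2 = 0.
  by rewrite mulrBl mul1r {1}bE /e2; ring.
pose h := (1 - e1) * (1 - e2).
have ha2 : (h * a) ^+ 2 = 0.
  by transitivity (h * (1 - e2) * ((1 - e1) * a ^+ 2)); rewrite /h;
    [ring | rewrite a2 mulr0].
have hb2 : (h * b) ^+ 2 = 0.
  by transitivity (h * (1 - e1) * ((1 - e2) * b ^+ 2)); rewrite /h;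
    [ring | rewrite b2 mulr0].
have [c [d [y [z [da aE']]]]] := one_semiregular_pair hR ha2 hb2.
have [u cE] := one_semiregular_sqr hR c.
pose g := c ^+ 2 * u.
have gg : g * g = g.
  by transitivity (c ^+ 4 * u * u); rewrite /g; [ring | rewrite -cE; ring].
have c2 : (1 - g) * c ^+ 2 = 0.
  by rewrite mulrBl mul1r {1}cE /g; ring.
have gb : g * (h * b) = h * a * (c * u * d).
  by transitivity (c * u * (c * (h * b)));
    [rewrite /g; ring | rewrite -da; ring].
have ga : (1 - g) * (h * a) = h * b * ((1 - g) * (z + y * c * z)).
  (* The relation [aE'] is used twice, so that [c] occurs squared. *)
  rewrite aE' {1}aE'.
  transitivity (h * b * ((1 - g) * (z + y * c * z)) +
                (y ^+ 2 * h * a) * ((1 - g) * c ^+ 2)).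
    ring.
  by rewrite c2 mulr0 addr0.
have e1h : e1 * h = 0.
  by transitivity ((e1 - e1 * e1) * (1 - e2)); rewrite /h;
    [ring | rewrite e1e1; ring].
have hh : h * h = h.
  transitivity ((1 - e1 * 2%:R + e1 * e1) * (1 - e2 * 2%:R + e2 * e2)).
    by rewrite /h; ring.
  by rewrite e1e1 e2e2 /h; ring.
(* [a] is a unit on [e1], and divides [b] on the part [g] of [h]. *)
exists (e1 + h * g), (a * v * b + h * (c * u * d)).
exists (b * w * (1 - e1) * a +
  h * ((1 - g) * (z + y * c * z))); split.
- transitivity (e1 * e1 + 2%:R * (e1 * h) * g + h * h * (g * g)); first by ring.
  by rewrite e1e1 e1h hh gg mulr0 mul0r addr0.
- transitivity (a * (a * v * b) + g * (h * b)); first by rewrite /e1; ring.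
  by rewrite gb; ring.
- transitivity (b * (b * w * (1 - e1) * a) + (1 - g) * (h * a)).
    by rewrite /h /e2; ring.
  by rewrite ga; ring.
Qed.

(** * Diagonal reduction *)

Lemma mx_invertible1 (R : comPzRingType) n : mx_invertible (1%:M : 'M[R]_n).
Proof. by exists 1%:M; rewrite mulmx1. Qed.

Lemma mx_invertibleM (R : comPzRingType) n (P Q : 'M[R]_n) :
  mx_invertible P -> mx_invertible Q -> mx_invertible (P *m Q).
Proof.
move=> [P' [PP' P'P]] [Q' [QQ' Q'Q]]; exists (Q' *m P'); split.
  by rewrite mulmxA -(mulmxA P) QQ' mulmx1.
by rewrite mulmxA -(mulmxA Q') P'P mulmx1.
Qed.

Lemma mx_invertible_tperm (R : comPzRingType) n (i j : 'I_n) :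
  mx_invertible (tperm_mx i j : 'M[R]_n).
Proof. by exists (tperm_mx i j); rewrite -perm_mxM tperm2 perm_mx1. Qed.

Lemma mx_invertible_tr (R : comPzRingType) n (P : 'M[R]_n) :
  mx_invertible P -> mx_invertible P^T.
Proof.
by move=> [P' [PP' P'P]]; exists P'^T; rewrite -!trmx_mul PP' P'P trmx1.
Qed.

(** An idempotent splits [R] as a product of rings, and a matrix over the
    product is invertible when both of its components are. *)
Lemma mx_invertible_patch (R : comPzRingType) n (e : R) (P Q : 'M[R]_n) :
  e * e = e -> mx_invertible P -> mx_invertible Q ->
  mx_invertible (e *: P + (1 - e) *: Q).
Proof.
move=> ee.
have patchM (A B C D : 'M[R]_n) : A *m B = 1%:M -> C *m D = 1%:M ->
    (e *: A + (1 - e) *: C) *m (e *: B + (1 - e) *: D) = 1%:M.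
  move=> AB CD; rewrite mulmxDl !mulmxDr -!scalemxAl -!scalemxAr AB CD !scalerA.
  have -> : e * (1 - e) = 0 by rewrite mulrBr mulr1 ee subrr.
  have -> : (1 - e) * e = 0 by rewrite mulrBl mul1r ee subrr.
  have -> : (1 - e) * (1 - e) = 1 - e.
    by rewrite mulrBr mulr1 mulrBl mul1r ee subrr subr0.
  by rewrite !scale0r addr0 add0r ee -scalerDl subrKC scale1r.
move=> [P' [PP' P'P]] [Q' [QQ' Q'Q]].
by exists (e *: P' + (1 - e) *: Q'); split; apply: patchM.
Qed.

Lemma mx_invertible_shear (R : comPzRingType) m n (C : 'M[R]_(n, m)) :
  mx_invertible (block_mx 1%:M 0 C 1%:M : 'M_(m + n)).
Proof.
exists (block_mx 1%:M 0 (- C) 1%:M).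
by rewrite !mulmx_block !(mulmx0, mul0mx, mulmx1, mul1mx, addr0, add0r)
           ?subrr ?addNr -scalar_mx_block.
Qed.

Lemma mx_invertible_block (R : comPzRingType) m n (P : 'M[R]_n) :
  mx_invertible P -> mx_invertible (block_mx 1%:M 0 0 P : 'M_(m + n)).
Proof.
move=> [P' [PP' P'P]]; exists (block_mx 1%:M 0 0 P').
by rewrite !mulmx_block !(mulmx0, mul0mx, mulmx1, mul1mx, addr0, add0r)
           PP' P'P -scalar_mx_block.
Qed.

Section ElementaryDivisors.
Context (R : comPzRingType).
Hypothesis comparable : idempotent_comparable R.

(** The pivot is made to divide the entries of [A] one at a time. If the pivot
    [a] divides the next entry [b] on the component [e] and is divisible by it
    on [1 - e], keep the current transformation on [e] and on [1 - e] use
    instead the row and column swaps that bring [b] to the corner. *)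
Lemma pivot m n (A : 'M[R]_(1 + m, 1 + n)) :
  exists P Q Z, [/\ mx_invertible P, mx_invertible Q &
    A = (P *m A *m Q) 0 0 *: Z].
Proof.
suff [P [Q [Pinv Qinv PQ]]] : exists P Q, [/\ mx_invertible P, mx_invertible Q &
    forall k, k \in enum (setT : {set 'I_(1 + m) * 'I_(1 + n)}) ->
    exists x, A k.1 k.2 = (P *m A *m Q) 0 0 * x].
  have /choice[z zE] k : exists x, A k.1 k.2 = (P *m A *m Q) 0 0 * x.
    by apply: PQ; rewrite mem_enum inE.
  exists P, Q, (\matrix_(i, j) z (i, j)); split=> //.
  by apply/matrixP => i j; rewrite [RHS]mxE mxE -zE.
elim: (enum _) => [|[i j] s [P [Q [Pinv Qinv PQ]]]].
  by exists 1%:M, 1%:M; split=> //; apply: mx_invertible1.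
have [e [x [y [ee ebE eaE]]]] := comparable ((P *m A *m Q) 0 0) (A i j).
pose P1 : 'M[R]_(1 + m) := tperm_mx 0 i.
pose Q1 : 'M[R]_(1 + n) := tperm_mx 0 j.
exists (e *: P + (1 - e) *: P1), (e *: Q + (1 - e) *: Q1).
have -> : (e *: P + (1 - e) *: P1) *m A *m (e *: Q + (1 - e) *: Q1) =
    e *: (P *m A *m Q) + (1 - e) *: (P1 *m A *m Q1).
  have ee0 : e * (1 - e) = 0 by rewrite mulrBr mulr1 ee subrr.
  have ee1 : (1 - e) * (1 - e) = 1 - e by rewrite mulrBl mul1r ee0 subr0.
  rewrite !mulmxDl !mulmxDr -!scalemxAl -!scalemxAr !scalerA.
  by rewrite [(1 - e) * e]mulrC ee0 !scale0r addr0 add0r ee ee1.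
have P1Q1 : (P1 *m A *m Q1) 0 0 = A i j.
  rewrite -[Q1]/(tperm_mx 0 j) -xcolE -[P1]/(tperm_mx 0 i) -xrowE.
  by rewrite !mxE !tpermL.
have gE : (e *: (P *m A *m Q) + (1 - e) *: (P1 *m A *m Q1)) 0 0 =
    e * (P *m A *m Q) 0 0 + (1 - e) * A i j.
  by rewrite mxE [X in X + _]mxE [X in _ + X]mxE P1Q1.
rewrite gE; move: ((P *m A *m Q) 0 0) PQ ebE eaE => a PQ ebE eaE.
split; try by [apply: mx_invertible_patch => //; apply: mx_invertible_tperm].
have e0 : e - e * e = 0 by rewrite ee subrr.
have nn : (1 - e) * (1 - e) = 1 - e.
  by transitivity (1 - e - (e - e * e)); [ring | rewrite e0 subr0].
set b := A i j in ebE eaE *.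
have aE : a = (e * a + (1 - e) * b) * (e + (1 - e) * y).
  transitivity (e * e * a + (e - e * e) * (a * y + b) +
                (1 - e) * (1 - e) * (b * y)); last by ring.
  by rewrite -eaE mulrA nn nn ee; ring.
have bE : b = (e * a + (1 - e) * b) * (e * x + (1 - e)).
  transitivity (e * e * (a * x) + (e - e * e) * (a + b * x) +
                (1 - e) * (1 - e) * b); last by ring.
  by rewrite -ebE mulrA nn !ee; ring.
move=> k; rewrite inE => /orP[/eqP-> /=|/PQ[z ->]].
  by exists (e * x + (1 - e)).
by exists ((e + (1 - e) * y) * z); rewrite mulrA -aE.
Qed.

(** Once the pivot divides all entries, shears clear its row and column, and
    induction applies to the remaining block. *)
Lemma comparable_elementary_divisor_ring : elementary_divisor_ring R.
Proof.
elim=> [|m IH] [|n] A; try by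
  exists 1%:M, A, 1%:M; rewrite mul1mx mulmx1; split=> //;
  try exact: mx_invertible1; apply/is_diag_mxP => i j; by [case: i | case: j].
have [P [Q [Z [Pinv Qinv AE]]]] := @pivot m n A.
set g := (_ *m Q) 0 0 in AE.
pose W : 'M_(1 + m, 1 + n) := P *m Z *m Q.
have BE : P *m A *m Q = g *: W by rewrite {1}AE -scalemxAr -scalemxAl.
have ulE : g *: ulsubmx W = g%:M.
  transitivity (ulsubmx (P *m A *m Q)); last first.
    apply/matrixP => i j; rewrite !ord1 [RHS]mxE eqxx [LHS]mxE [LHS]mxE.
    by rewrite !lshift0.
  by rewrite BE; apply/matrixP => i j; rewrite !mxE.
pose r := ursubmx W; pose c := dlsubmx W.
pose S := g *: (drsubmx W - c *m r).
have [P' [D [Q' [P'inv Q'inv D_diag DE]]]] := IH n S.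
pose L : 'M_(1 + m) := block_mx 1%:M 0 (- c) 1%:M.
pose U : 'M_(1 + n) := block_mx 1%:M (- r) 0 1%:M.
have LBU : L *m (P *m A *m Q) *m U = block_mx g%:M 0 0 S.
  rewrite BE -[W]submxK scale_block_mx ulE !mulmx_block.
  rewrite !(mulmx0, mul0mx, mulmx1, mul1mx, addr0, add0r).
  rewrite mulNmx -scalemxAr mul_scalar_mx.
  rewrite scalar_mxC !mul_scalar_mx -/r -/c scalerN !addNr mul0mx add0r.
  rewrite /S scalerBr mulNmx scalerN.
  by rewrite addrC.
exists (block_mx 1%:M 0 0 P' *m L *m P).
exists (block_mx g%:M 0 0 D : 'M_(1 + m, 1 + n)).
exists (Q *m (U *m block_mx 1%:M 0 0 Q')); split.
- apply: mx_invertibleM => //; apply: mx_invertibleM.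
    exact: (@mx_invertible_block _ 1).
  exact: (@mx_invertible_shear _ 1).
- apply: mx_invertibleM => //; apply: mx_invertibleM.
    have -> : U = (block_mx 1%:M 0 (- r^T) 1%:M)^T.
      by rewrite tr_block_mx !trmx1 trmx0 linearN /= trmxK.
    exact/mx_invertible_tr/(@mx_invertible_shear _ 1).
  exact: (@mx_invertible_block _ 1).
- apply: (etrans (@is_diag_block_mx _ 1 m 1 n _ _ _ _ erefl)).
  by rewrite !eqxx D_diag andbT; apply/is_diag_mxP => i j; rewrite !ord1.
transitivity (block_mx 1%:M 0 0 P' *m (L *m (P *m A *m Q) *m U) *m
              block_mx 1%:M 0 0 Q').
  by rewrite !mulmxA.
rewrite LBU !mulmx_block !(mulmx0, mul0mx, mulmx1, mul1mx, addr0, add0r).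
by rewrite DE.
Qed.
End ElementaryDivisors.

(** * Row spaces and kernels *)

(** The cokernel of [B] embeds into a projective module, hence into a free
    one, and the kernel of the resulting matrix [C] is the row space of [B].
    Concretely [1 - Y N] is the projection with kernel the row space of [N]. *)
Lemma rowspace_is_kernel (R : comPzRingType) (hR : one_semiregular R)
    m n (B : 'M[R]_(m, n)) :
  exists k (C : 'M[R]_(n, k)), forall p (V : 'M[R]_(p, n)),
    V *m C = 0 <-> exists U, V = U *m B.
Proof.
have [C [Y [NYN rowB]]] := periodic_relations hR B.
set N := block_mx _ _ _ _ in NYN rowB.
exists (n + n), (usubmx (1%:M - Y *m N)) => p V.
have VE : V *m usubmx (1%:M - Y *m N) = row_mx V 0 *m (1%:M - Y *m N).
  by rewrite -[in RHS](vsubmxK (1%:M - _)) mul_row_col mul0mx addr0.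
rewrite VE mulmxBr mulmx1 mulmxA; split=> [/subr0_eq VYN|[U ->]].
  have /choice[u uE] i : exists u, row i V = u *m B.
    apply: (rowB _ (row i (row_mx V 0 *m Y))).
    by rewrite -row_mul -VYN row_row_mx; congr row_mx; rewrite raddf0.
  by exists (\matrix_i u i); apply/row_matrixP => i; rewrite uE row_mul rowK.
have -> : row_mx (U *m B) 0 = row_mx U 0 *m N.
  by rewrite mul_row_block !mul0mx mulmx0 !addr0.
by rewrite -!mulmxA [N *m _]mulmxA NYN subrr.
Qed.

(** Coherence, by a double annihilator argument: the row space of [C^T] is the
    kernel of some [B], and then the rows of [B^T] span the left kernel of [C],
    because their row space is itself a kernel. *)
Lemma kernel_is_rowspace (R : comPzRingType) (hR : one_semiregular R)
    n k (C : 'M[R]_(n, k)) :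
  exists m (B : 'M[R]_(m, n)), forall p (V : 'M[R]_(p, n)),
    V *m C = 0 <-> exists U, V = U *m B.
Proof.
have [m [B CB]] := rowspace_is_kernel hR C^T.
have [q [G BG]] := rowspace_is_kernel hR B^T.
exists m, B^T => p V; split=> [VC|[U ->]].
  apply/BG; have /CB[X /(congr1 trmx)] : G^T *m B = 0.
    apply: trmx_inj; rewrite trmx_mul trmxK trmx0.
    by apply/BG; exists 1%:M; rewrite mul1mx.
  by rewrite trmx_mul !trmxK => ->; rewrite mulmxA VC mul0mx.
rewrite -mulmxA; suff -> : B^T *m C = 0 by rewrite mulmx0.
apply: trmx_inj; rewrite trmx_mul trmxK trmx0.
by apply/CB; exists 1%:M; rewrite mul1mx.
Qed.

(** * A flat module of germs containing a given module *)

(** The equational criterion: every relation between elements of [F] comes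
    from expressing these elements through others with coefficients [D] that
    satisfy the relation already over [R]. *)
Definition equationally_flat (R : comPzRingType) (F : lmodType R) : Prop :=
  forall k (y : 'I_k -> F) p (A : 'M[R]_(p, k)),
    (forall i, comb y (row i A) = 0) ->
    exists q (z : 'I_q -> F) (D : 'M_(k, q)),
      A *m D = 0 /\ forall r, comb y r = comb z (r *m D).

Section Envelope.
Context (R : comPzRingType) (M : lmodType R).

(** A triple [(a, x, y)] records one instance of linearity, so [l] is a finite
    part of the conditions for [psi] to be a linear functional. *)
Definition linear_on (l : seq (R * M * M)) (psi : M -> R) : Prop :=
  forall t, t \in l ->
    psi (t.1.1 *: t.1.2 + t.2) = t.1.1 * psi t.1.2 + psi t.2.

Definition null_germ (g : (M -> R) -> R^o) : Prop :=
  exists l, forall psi, linear_on l psi -> g psi = 0.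

Lemma linear_on_cat l l' psi :
  linear_on (l ++ l') psi -> linear_on l psi /\ linear_on l' psi.
Proof. by move=> h; split=> t tl; apply: h; rewrite mem_cat tl ?orbT. Qed.

Lemma null_germ0 : null_germ 0.
Proof. by exists [::]. Qed.

Lemma null_germP a g h : null_germ g -> null_germ h -> null_germ (a *: g + h).
Proof.
move=> [l gl] [l' hl']; exists (l ++ l') => psi /linear_on_cat[/gl g0 /hl' h0].
have -> : (a *: g + h) psi = a * g psi + h psi by [].
by rewrite g0 h0 mulr0 addr0.
Qed.

(** The functions of a functional [psi], where functions that agree as soon as
    [psi] is linear on some finite list are identified. This is the colimit over
    [l] of the powers of [R] indexed by the functionals linear on [l]; a linear
    functional on [M] itself need not separate its points, but the finitely
    presented approximations of [M] have enough functionals. *)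
Definition envelope := quotient (Submodule null_germ0 null_germP).

Definition germ g : envelope := class _ g.

Lemma germ_linear : linear germ. Proof. exact: class_linear. Qed.

HB.instance Definition _ :=
  GRing.isLinear.Build R ((M -> R) -> R^o) envelope *:%R germ germ_linear.

Definition evaluation (x : M) : envelope := germ (fun psi => psi x).

Lemma evaluation_linear : linear evaluation.
Proof.
move=> a x y; rewrite -germ_linear; apply/class_eqP.
exists [:: (a, x, y)] => psi psi_lin.
have := psi_lin (a, x, y) (mem_head _ _) => /= psiP.
transitivity (psi (a *: x + y) - (a * psi x + psi y)); first by [].
by rewrite psiP subrr.
Qed.

HB.instance Definition _ :=
  GRing.isLinear.Build R M envelope *:%R evaluation evaluation_linear.

(** The conditions in [l] together with [x] involve finitely many elements of
    [M]. The module that they generate subject to the relations in [l] is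
    finitely presented, hence embeds into a free module; the coordinates of the
    embedding are functionals linear on [l] that detect [x]. *)
Lemma linear_on_separates (hR : one_semiregular R) l (x : M) :
  (forall psi, linear_on l psi -> psi x = 0) -> x = 0.
Proof.
move=> x0.
pose ys := x :: flatten [seq [:: t.1.1 *: t.1.2 + t.2; t.1.2; t.2] | t <- l].
(* The extra coordinate receives the elements outside [ys], where
   [index z ys] is [size ys]. *)
pose e z : 'rV[R]_(size ys).+1 := delta_mx 0 (inord (index z ys)).
pose y (j : 'I_(size ys).+1) := nth 0 ys j.
have eK z : z \in ys -> comb y (e z) = z.
  by move=> zys; rewrite comb_delta /y inordK ?nth_index // ltnS index_size.
have ys_l t : t \in l ->
    [/\ t.1.1 *: t.1.2 + t.2 \in ys, t.1.2 \in ys & t.2 \in ys].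
  move=> tl; have sub : {subset [:: t.1.1 *: t.1.2 + t.2; t.1.2; t.2] <= ys}.
    move=> z zt; rewrite inE; apply/orP; right; apply/flatten_mapP.
    by exists t.
  by split; apply: sub; rewrite !inE eqxx ?orbT.
pose B := \matrix_(k < size l)
  let t := tnth (in_tuple l) k in
  e (t.1.1 *: t.1.2 + t.2) - (t.1.1 *: e t.1.2 + e t.2).
have combB u : comb y (u *m B) = 0.
  rewrite mulmx_sum_row linear_sum big1 // => k _.
  have [t1 t2 t3] := ys_l _ (mem_tnth k (in_tuple l)).
  by rewrite linearZ rowK /= linearB linearP /= !eK // subrr scaler0.
have [q [C CB]] := rowspace_is_kernel hR B.
have BC : B *m C = 0 by apply/CB; exists 1%:M; rewrite mul1mx.
have /CB[w ew] : e x *m C = 0.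
  apply/rowP => j; rewrite [RHS]mxE.
  apply: (x0 (fun z => (e z *m C) 0 j)) => t /(tnthP (in_tuple l))[k ->].
  have : row k (B *m C) = 0 by rewrite BC raddf0.
  rewrite row_mul rowK /= mulmxBl mulmxDl -scalemxAl => /subr0_eq/rowP/(_ j) ->.
  by rewrite [LHS]mxE [X in X + _]mxE.
by rewrite -[x]eK ?mem_head // ew combB.
Qed.

Lemma evaluation_inj (hR : one_semiregular R) : injective evaluation.
Proof.
move=> x y /eqP; rewrite -subr_eq0 -linearB => /eqP /class_eq0[l l0].
by apply/subr0_eq/(linear_on_separates hR); apply: l0.
Qed.

Lemma comb_germ k (g : 'I_k -> (M -> R) -> R^o) r :
  comb (fun j => germ (g j)) r = germ (fun psi => \sum_j r 0 j * g j psi).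
Proof.
transitivity (germ (\sum_j r 0 j *: g j)).
  by rewrite linear_sum; apply: eq_bigr => j _; rewrite linearZ.
by congr germ; apply/funext => psi; rewrite fct_sumE.
Qed.

(** A relation between germs holds for all [psi] linear on some list. For each
    such [psi] it is a linear system over [R], whose solutions form a row space
    with a spanning matrix [B] independent of [psi]; the coefficients of the
    solution in terms of [B], as functions of [psi], are the required germs. *)
Lemma envelope_equationally_flat (hR : one_semiregular R) :
  equationally_flat envelope.
Proof.
move=> k y p A Ay0.
have /choice[g gE] j : exists g, germ g = y j by apply: class_surj.
have yE r : comb y r = germ (fun psi => \sum_j r 0 j * g j psi).
  by rewrite -comb_germ; apply: eq_bigr => j _; rewrite gE.
have /choice[l lP] i : exists l, forall psi, linear_on l psi ->
    \sum_j A i j * g j psi = 0.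
  have /class_eq0[l lP] := etrans (esym (yE (row i A))) (Ay0 i).
  exists l => psi /lP g0; rewrite -[RHS]g0.
  by apply: eq_bigr => j _; rewrite mxE.
have [q [B BP]] := kernel_is_rowspace hR A^T.
pose L := flatten [seq l i | i <- enum 'I_p].
have /choice[u uP] psi : exists u : 'rV_q, linear_on L psi ->
    \row_j (g j psi : R) = u *m B.
  have [psiL|psiL] := pselect (linear_on L psi); last by exists 0.
  suff /BP[u uE] : \row_j (g j psi : R) *m A^T = 0 by exists u.
  apply/rowP => i; rewrite !mxE; transitivity (\sum_j A i j * g j psi).
    by apply: eq_bigr => j _; rewrite !mxE mulrC.
  apply: lP => t tl; apply: psiL; apply/flatten_mapP.
  by exists i; rewrite ?mem_enum.
pose z (i : 'I_q) := germ (fun psi => u psi 0 i).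
exists q, z, B^T; split.
  apply: trmx_inj; rewrite trmx_mul trmxK trmx0.
  by apply/BP; exists 1%:M; rewrite mul1mx.
move=> r; rewrite yE comb_germ; apply/class_eqP; exists L => psi /uP gu.
apply/eqP; rewrite subr_eq0; apply/eqP.
transitivity ((r *m (\row_j (g j psi : R))^T) 0 0).
  by rewrite mxE; apply: eq_bigr => j _; rewrite !mxE.
rewrite gu trmx_mul mulmxA [LHS]mxE.
by apply: eq_bigr => i _; rewrite [_^T i 0]mxE.
Qed.
End Envelope.

(** * Flatness from the equational criterion *)

Section TensorSums.
Context (R : comPzRingType) (B F : lmodType R).

Lemma tens0l (f : F) : tens (0 : B) f = 0.
Proof. by rewrite -(scale0r 0) tensZl scale0r. Qed.

Lemma tens0r (x : B) : tens x (0 : F) = 0.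
Proof. by rewrite -(scale0r 0) tensZr scale0r. Qed.

Lemma tens_combr (x : B) k (y : 'I_k -> F) r :
  tens x (comb y r) = \sum_j r 0 j *: tens x (y j).
Proof.
rewrite (big_morph _ (tensDr x) (tens0r x)).
by apply: eq_bigr => j _; rewrite tensZr.
Qed.

(** The coordinates of an element of the tensor product of [B] with a free
    module of rank [k], given as the formal sum of the [x (x) r]. *)
Definition coefs k (xs : seq B) (rs : seq 'rV[R]_k) (j : 'I_k) : B :=
  \sum_(p <- zip xs rs) p.2 0 j *: p.1.

Lemma coefs_cons k x xs r (rs : seq 'rV[R]_k) j :
  coefs (x :: xs) (r :: rs) j = r 0 j *: x + coefs xs rs j.
Proof. by rewrite /coefs big_cons. Qed.

Lemma coefs_nil k j : coefs [::] ([::] : seq 'rV[R]_k) j = 0.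
Proof. by rewrite /coefs big_nil. Qed.

Lemma coefs_cat k xs xs' (rs rs' : seq 'rV[R]_k) j : size xs = size rs ->
  coefs (xs ++ xs') (rs ++ rs') j = coefs xs rs j + coefs xs' rs' j.
Proof. by move=> eq_size; rewrite /coefs zip_cat // big_cat. Qed.

Lemma coefs_mulmx k l xs (rs : seq 'rV[R]_k) (D : 'M_(k, l)) j :
  coefs xs (map (mulmxr D) rs) j = \sum_i D i j *: coefs xs rs i.
Proof.
elim: xs rs => [|x xs IH] [|r rs];
  try by rewrite /coefs /= big_nil big1 // => i _; rewrite big_nil scaler0.
rewrite coefs_cons IH mxE scaler_suml -big_split; apply: eq_bigr => i _ /=.
by rewrite coefs_cons scalerDr scalerA mulrC.
Qed.

Lemma sum_tens_coefs (s : seq (B * F)) k (y : 'I_k -> F) rs :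
  unzip2 s = map (comb y) rs ->
  \sum_(p <- s) tens p.1 p.2 = \sum_j tens (coefs (unzip1 s) rs j) (y j).
Proof.
elim: s rs => [|[x f] s IH] [|r rs] //=.
  by move=> _; rewrite big_nil big1 // => j _; rewrite coefs_nil tens0l.
move=> [fE /IH {}IH]; rewrite big_cons IH fE /= tens_combr -big_split.
by apply: eq_bigr => j _; rewrite coefs_cons tensDl tensZl.
Qed.

(** The map [comb y] goes from a free module to [F]; two formal sums over
    [B * F] are identified when they lift along it to equal elements of the
    tensor product of [B] with the free module. *)
Definition lifts k (y : 'I_k -> F) (s t : seq (B * F)) : Prop :=
  exists rs rt, [/\ unzip2 s = map (comb y) rs, unzip2 t = map (comb y) rt &
    coefs (unzip1 s) rs =1 coefs (unzip1 t) rt].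

Definition lifted_eq (s t : seq (B * F)) : Prop :=
  exists k (y : 'I_k -> F), lifts y s t.

Lemma lifts_change k l (y : 'I_k -> F) (z : 'I_l -> F) D s t :
  (forall r, comb y r = comb z (r *m D)) -> lifts y s t -> lifts z s t.
Proof.
move=> yz [rs [rt [sE tE coefE]]].
exists (map (mulmxr D) rs), (map (mulmxr D) rt); split.
- by rewrite sE -map_comp; apply: eq_map.
- by rewrite tE -map_comp; apply: eq_map.
- by move=> j; rewrite !coefs_mulmx; apply: eq_bigr => i _; rewrite coefE.
Qed.

Lemma lifted_eq_common s s' t t' : lifted_eq s s' -> lifted_eq t t' ->
  exists k (y : 'I_k -> F), lifts y s s' /\ lifts y t t'.
Proof.
move=> [k [y ss']] [l [z tt']].
pose w i := match fintype.split i with inl i => y i | inr i => z i end.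
have wl i : w (lshift l i) = y i.
  by rewrite /w; case: splitP => j /= /eqP;
    [move/eqP/val_inj-> | rewrite ltn_eqF // ltn_addr].
have wr i : w (rshift k i) = z i.
  rewrite /w; case: splitP => j /= /eqP; last first.
    by rewrite eqn_add2l => /eqP/val_inj->.
  by rewrite gtn_eqF // ltn_addr.
exists (k + l)%N, w; split.
  apply: (lifts_change (D := row_mx 1%:M 0)) ss' => r.
  rewrite mul_mx_row mulmx1 mulmx0 /comb big_split_ord /=.
  rewrite [X in _ = _ + X]big1 ?addr0 => [|i _]; last first.
    by rewrite row_mxEr mxE scale0r.
  by apply: eq_bigr => i _; rewrite row_mxEl wl.
apply: (lifts_change (D := row_mx 0 1%:M)) tt' => r.
rewrite mul_mx_row mulmx1 mulmx0 /comb big_split_ord /=.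
rewrite [X in _ = X + _]big1 ?add0r => [|i _]; last first.
  by rewrite row_mxEl mxE scale0r.
by apply: eq_bigr => i _; rewrite row_mxEr wr.
Qed.

Lemma lifted_eq_refl s : lifted_eq s s.
Proof.
pose fs := in_tuple (unzip2 s).
exists (size (unzip2 s)), (tnth fs).
pose rs := [seq (delta_mx 0 j : 'rV[R]__) | j <- enum 'I_(size (unzip2 s))].
suff sE : unzip2 s = map (comb (tnth fs)) rs by exists rs, rs.
rewrite -map_comp -[LHS](map_tnth_enum fs).
by apply: eq_map => j; rewrite /= comb_delta.
Qed.

Lemma size_lift (s : seq (B * F)) k (y : 'I_k -> F) rs :
  unzip2 s = map (comb y) rs -> size (unzip1 s) = size rs.
Proof. by move/(congr1 size); rewrite !size_map. Qed.

Lemma lifted_eq_cat s s' t t' :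
  lifted_eq s s' -> lifted_eq t t' -> lifted_eq (s ++ t) (s' ++ t').
Proof.
move=> ss' tt'; have [k [y []]] := lifted_eq_common ss' tt'.
move=> [rs [rs' [sE s'E ssE]]] [rt [rt' [tE t'E ttE]]].
exists k, y, (rs ++ rt), (rs' ++ rt').
split; rewrite ?[unzip2 _]map_cat ?[RHS]map_cat -?(sE, s'E, tE, t'E) // => j.
by rewrite ![unzip1 (_ ++ _)]map_cat !coefs_cat ?ssE ?ttE //;
  apply: (@size_lift _ _ y).
Qed.

Lemma lifted_eq_catC s t : lifted_eq (s ++ t) (t ++ s).
Proof.
have [k [y []]] := lifted_eq_common (lifted_eq_refl s) (lifted_eq_refl t).
move=> [rs [_ [sE _ _]]] [rt [_ [tE _ _]]].
exists k, y, (rs ++ rt), (rt ++ rs).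
split; rewrite ?[unzip2 _]map_cat ?[RHS]map_cat -?(sE, tE) // => j.
by rewrite ![unzip1 (_ ++ _)]map_cat !coefs_cat 1?addrC //;
  apply: (@size_lift _ _ y).
Qed.

Hypothesis flatF : equationally_flat F.

(** Two chains of lifts give two lifts of the middle term [t], which differ by
    rows in the kernel of [comb y]. By the equational criterion these rows are
    annihilated by a change of basis, after which the two lifts coincide. *)
Lemma lifted_eq_trans s t u :
  lifted_eq s t -> lifted_eq t u -> lifted_eq s u.
Proof.
move=> st tu; have [k [y []]] := lifted_eq_common st tu.
move=> [rs [rt [sE tE stE]]] [rt' [ru [tE' uE tuE]]].
have eq_size : size rt = size rt'.
  by move: (congr1 size tE) (congr1 size tE'); rewrite !size_map => -> ->.
pose A := \matrix_(i < size rt) (nth 0 rt i - nth 0 rt' i).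
have [|q [z [D [AD yz]]]] := @flatF _ y _ A.
  move=> i; rewrite rowK linearB /= -(nth_map 0 (comb y 0)) //.
  rewrite -[comb y (nth 0 rt' i)](nth_map 0 (comb y 0)) -?eq_size //.
  by rewrite -tE -tE' subrr.
have rtD : map (mulmxr D) rt = map (mulmxr D) rt'.
  apply: (@eq_from_nth _ 0) => [|i]; rewrite size_map ?size_map // => ltit.
  rewrite !(nth_map 0) -?eq_size //; apply/eqP; rewrite -subr_eq0 -linearB /=.
  have <- : row (Ordinal ltit) A = nth 0 rt i - nth 0 rt' i by rewrite rowK.
  by rewrite -row_mul AD raddf0.
exists q, z, (map (mulmxr D) rs), (map (mulmxr D) ru); split.
- by rewrite sE -map_comp; apply: eq_map.
- by rewrite uE -map_comp; apply: eq_map.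
move=> j; transitivity (coefs (unzip1 t) (map (mulmxr D) rt) j).
  by rewrite !coefs_mulmx; apply: eq_bigr => i _; rewrite stE.
by rewrite rtD !coefs_mulmx; apply: eq_bigr => i _; rewrite tuE.
Qed.

(** Equality in the tensor product is witnessed over a free module: the relation
    [lifted_eq] is a congruence that contains the bilinearity relations. *)
Lemma tens_eq_lifted s t : tens_eq s t -> lifted_eq s t.
Proof.
pose d : 'rV[R]_1 := delta_mx 0 0.
have comb1 (f : F) : comb (fun=> f) d = f by rewrite comb_delta.
elim=> {s t} [s|s t _ [k [y [rs [rt [? ? st]]]]]|s t u _ st _|s s' t t' _ ss' _
             |s t|f|x x' f|x f f'|a x f].
- exact: lifted_eq_refl.
- by exists k, y, rt, rs; split=> // j; rewrite st.
- exact: lifted_eq_trans.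
- exact: lifted_eq_cat.
- exact: lifted_eq_catC.
- exists 1%N, (fun=> f), [:: d], [::]; split; rewrite /= ?comb1 // => j.
  by rewrite coefs_cons !coefs_nil scaler0 addr0.
- exists 1%N, (fun=> f), [:: d], [:: d; d]; split; rewrite /= ?comb1 // => j.
  by rewrite !coefs_cons !coefs_nil !addr0 scalerDr.
- pose y (j : 'I_2) := if j == 0 then f else f'.
  pose e j : 'rV[R]_2 := delta_mx 0 j.
  exists 2%N, y, [:: e 0 + e 1], [:: e 0; e 1]; split.
  + by rewrite /= linearD /= !comb_delta.
  + by rewrite /= !comb_delta.
  + by move=> j; rewrite !coefs_cons !coefs_nil !addr0 mxE scalerDl.
- exists 1%N, (fun=> f), [:: d], [:: a *: d]; split.
  + by rewrite /= comb1.
  + by rewrite /= linearZ /= comb1.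
  + move=> j; rewrite !coefs_cons !coefs_nil !addr0 [in RHS]mxE.
    by rewrite scalerA mulrC.
Qed.
End TensorSums.

Lemma coefs_map (R : comPzRingType) (A B : lmodType R) (f : {linear A -> B})
    k xs (rs : seq 'rV[R]_k) j :
  coefs (map f xs) rs j = f (coefs xs rs j).
Proof.
elim: xs rs => [|x xs IH] [|r rs]; try by rewrite /coefs /= !big_nil linear0.
by rewrite /= !coefs_cons IH linearP.
Qed.

(** If two sums become equal in the tensor product of [B] with [F], they lift to
    sums with equal coordinates in [B]. These coordinates are the images under
    the injection [f] of the coordinates in [A], so they agree in [A]. *)
Lemma equationally_flat_flat (R : comPzRingType) (F : lmodType R) :
  equationally_flat F -> flat F.
Proof.
move=> flatF A B f f_inj u v; rewrite -[u]reprK -[v]reprK.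
move: (repr u) (repr v) => s t.
pose fs (s : seq (A * F)) := [seq (f p.1, p.2) | p <- s].
have map_pi s' :
    tensor_map F f (\pi_(tensor A F) s')%qT = (\pi_(tensor B F) (fs s'))%qT.
  rewrite !pi_tensorE linear_sum big_map; apply: eq_bigr => p _.
  exact: tensor_mapE.
rewrite !map_pi => /tensor_eqP/(tens_eq_lifted flatF).
move=> [k [y [rs [rt [sE tE stE]]]]].
have fs2 s' : unzip2 (fs s') = unzip2 s' by rewrite /unzip2 -map_comp.
have fs1 s' : unzip1 (fs s') = map f (unzip1 s').
  by rewrite /unzip1 -!map_comp.
rewrite !fs2 in sE tE.
rewrite !pi_tensorE (sum_tens_coefs sE) (sum_tens_coefs tE).
apply: eq_bigr => j _; congr tens; apply: f_inj.
by have := stE j; rewrite !fs1 !coefs_map.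
Qed.

(** * One-semiregular rings *)

Theorem corollary2p1 (R : comPzRingType) (hR : one_semiregular R) :
  elementary_divisor_ring R /\ semiregular R.
Proof.
split.
  exact: comparable_elementary_divisor_ring (one_semiregular_comparable hR).
move=> M; exists (envelope M), (@evaluation R M); split.
  exact/equationally_flat_flat/envelope_equationally_flat.
exact: evaluation_inj.
Qed.
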